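(* Let $\boldsymbol{\lambda}=(\lambda_k)_{k\in\mathbb{N}_0}$ be a sequence of positive reals with $0\le\lambda_0<1$ and $\sum_{k=0}^{\infty}\lambda_k^2=1$, and let $\beta:=\sup\{\lambda_0^2,\ \lambda_k^2/2 : k\in\mathbb{N}\}$. Then $\beta\in(0,1)$, and for every $d\in\mathbb{N}$ and $n\in\mathbb{N}_0$, while the initial error of $\mathrm{App}:\mathcal{H}_{\boldsymbol{\lambda}}(\mathbb{T}^d)\hookrightarrow L_\infty(\mathbb{T}^d)$ equals $1$, \[ e^{\mathrm{det}}\bigl(n,\mathcal{H}_{\boldsymbol{\lambda}}(\mathbb{T}^d)\hookrightarrow L_\infty(\mathbb{T}^d)\bigr)\ge\sqrt{(1-n\,\beta^d)_+}. \] Consequently, for every $\varepsilon\in(0,1)$, \[ n^{\mathrm{det}}\bigl(\varepsilon,\mathcal{H}_{\boldsymbol{\lambda}}(\mathbb{T}^d)\hookrightarrow L_\infty(\mathbb{T}^d)\bigr)\ge\beta^{-d}(1-\varepsilon)^2, \] so the problem suffers from the curse of dimensionality in the deterministic setting. In particular this holds for the Korobov spaces $\mathcal{H}^{\mathrm{Kor}}_r(\mathbb{T}^d)$ (with $r>1/2$, $\beta_0,\beta_1>0$, $\beta_0+\beta_1\zeta(2r)=1$) with $\beta=\sup\{\beta_0,\beta_1/2\}$.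
   Context: $\mathbb{T}=[0,1)$ is the one-dimensional torus (endpoints identified), $\mathbb{T}^d$ the $d$-torus with Lebesgue measure. For $\boldsymbol{\lambda}=(\lambda_k)_{k\in\mathbb{N}_0}\subset(0,\infty)$, $\mathcal{H}_{\boldsymbol{\lambda}}(\mathbb{T})$ is the real Hilbert space of functions on $\mathbb{T}$ having the orthonormal basis $\psi_0:=\lambda_0$, $\psi_{-k}:=\lambda_k\sin(2\pi k\,\cdot)$, $\psi_k:=\lambda_k\cos(2\pi k\,\cdot)$, $k\in\mathbb{N}$. $\mathcal{H}_{\boldsymbol{\lambda}}(\mathbb{T}^d)$ is the (unweighted) tensor product space with orthonormal basis $\psi_{\mathbf{k}}(\mathbf{x})=\prod_{j=1}^d\psi_{k_j}(x_j)$, $\mathbf{k}\in\mathbb{Z}^d$; its reproducing kernel is $K(\mathbf{x},\mathbf{y})=\prod_{j=1}^d\sum_{k=0}^\infty\lambda_k^2\cos(2\pi k(x_j-y_j))$. The Korobov space $\mathcal{H}^{\mathrm{Kor}}_r(\mathbb{T}^d)$ is $\mathcal{H}_{\boldsymbol{\lambda}}(\mathbb{T}^d)$ with $\lambda_0=\sqrt{\beta_0}$, $\lambda_k=\sqrt{\beta_1}\,k^{-r}$ ($k\in\mathbb{N}$); $\zeta$ is the Riemann zeta function. $a_+:=\max\{a,0\}$. Deterministic setting with linear information: a method is $A_n=\phi\circ N$ with $N(f)=(L_1(f),\ldots,L_n(f))$ for continuous linear functionals $L_i$ on the input space and arbitrary $\phi:\mathbb{R}^n\to L_\infty(\mathbb{T}^d)$;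 its error is $\sup_{\|f\|\le1}\|f-A_n(f)\|_{L_\infty}$; $e^{\mathrm{det}}(n,\cdot)$ is the infimum of this error over all such methods, and $n^{\mathrm{det}}(\varepsilon,\cdot)$ is the minimal $n\in\mathbb{N}_0$ for which some such method has error at most $\varepsilon$. The initial error is the operator norm of the embedding. *)

(* Defs.v *)
From HB Require Import structures.
From mathcomp Require Import all_boot all_order all_algebra.
From mathcomp Require Import all_classical all_reals all_analysis.
Import Order.TTheory GRing.Theory Num.Theory.
Import numFieldNormedType.Exports.
Local Open Scope classical_set_scope.
Local Open Scope ring_scope.

Section Defs.
Variable R : realType.

(** One-dimensional orthonormal basis: psi_0 = lam_0, psi_k = lam_k cos(2 pi k .),
    psi_{-k} = lam_k sin(2 pi k .)  (Negz n denotes -(n+1)). *)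
Definition psi1 (lam : nat -> R) (k : int) (t : R) : R :=
  match k with
  | Posz 0 => lam 0%N
  | Posz n.+1 => lam n.+1 * cos (2 * pi * n.+1%:R * t)
  | Negz n => lam n.+1 * sin (2 * pi * n.+1%:R * t)
  end.

Definition psi (lam : nat -> R) (d : nat) (k : 'I_d -> int) (x : 'I_d -> R) : R :=
  \prod_(j < d) psi1 lam (k j) (x j).

Definition boxsum (d K : nat) (F : ('I_d -> int) -> R) : R :=
  \sum_(k : {ffun 'I_d -> 'I_(K.*2.+1)}) F (fun j => (nat_of_ord (k j))%:Z - K%:Z).

Definition sq_summable (d : nat) (c : ('I_d -> int) -> R) : Prop :=
  exists M : R, forall K, boxsum d K (fun k => c k ^+ 2) <= M.

Definition l2sq (d : nat) (c : ('I_d -> int) -> R) : R :=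
  sup (range (fun K => boxsum d K (fun k => c k ^+ 2))).

Definition represents (lam : nat -> R) (d : nat) (c : ('I_d -> int) -> R)
    (f : ('I_d -> R) -> R) : Prop :=
  sq_summable d c /\
  forall x, (fun K => boxsum d K (fun k => c k * psi lam d k x)) @ \oo --> f x.

Definition inH lam d (f : ('I_d -> R) -> R) : Prop := exists c, represents lam d c f.

Definition Hnorm lam d (f : ('I_d -> R) -> R) : R :=
  inf [set Num.sqrt (l2sq d c) | c in [set c | represents lam d c f]].

Definition Hball lam d : set (('I_d -> R) -> R) :=
  [set f | inH lam d f /\ Hnorm lam d f <= 1].

Definition cont_lin_functional lam d (L : (('I_d -> R) -> R) -> R) : Prop :=
  (forall f g (a b : R), inH lam d f -> inH lam d g ->
     L (fun x => a * f x + b * g x) = a * L f + b * L g) /\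
  exists M : R, forall f, inH lam d f -> `|L f| <= M * Hnorm lam d f.

Definition torus d : set ('I_d -> R) := [set x | forall j, 0 <= x j < 1].

Definition dbox d (a b : 'I_d -> R) : set ('I_d -> R) :=
  [set x | forall j, a j <= x j <= b j].

Definition lnull d (N : set ('I_d -> R)) : Prop :=
  forall e : R, 0 < e -> exists a b : nat -> 'I_d -> R,
    [/\ (forall i j, a i j <= b i j),
        N `<=` \bigcup_i dbox d (a i) (b i) &
        forall n, \sum_(i < n) \prod_(j < d) (b i j - a i j) <= e].

Definition esssupT d (h : ('I_d -> R) -> R) : \bar R :=
  ereal_inf [set M%:E | M in [set M : R | lnull d [set x | torus d x /\ M < `|h x| ]]].

Definition measT d (h : ('I_d -> R) -> R) : Prop :=
  measurable_fun setT (fun t : d.-tuple R => h (fun j => tnth t j)).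

Definition method lam d n (L : 'I_n -> (('I_d -> R) -> R) -> R)
   (phi : ('I_n -> R) -> ('I_d -> R) -> R) : Prop :=
  (forall i, cont_lin_functional lam d (L i)) /\ (forall y, measT d (phi y)).

Definition err lam d n (L : 'I_n -> (('I_d -> R) -> R) -> R)
   (phi : ('I_n -> R) -> ('I_d -> R) -> R) : \bar R :=
  ereal_sup [set esssupT d (fun x => f x - phi (fun i => L i f) x) | f in Hball lam d].

Definition edet lam d n : \bar R :=
  ereal_inf [set e | exists L phi, method lam d n L phi /\ e = err lam d n L phi].

Definition init_err lam d : \bar R := ereal_sup [set esssupT d f | f in Hball lam d].

Definition achievable lam d n (eps : R) : Prop :=
  exists L phi, method lam d n L phi /\ (err lam d n L phi <= eps%:E)%E.

Definition betaOf (lam : nat -> R) : R :=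
  sup ([set lam 0%N ^+ 2] `|` [set lam k.+1 ^+ 2 / 2 | k in [set: nat]]).

Definition conclusions (lam : nat -> R) (beta : R) : Prop :=
  (0 < beta < 1) /\
  forall d, (0 < d)%N ->
    [/\ init_err lam d = 1%E,
        (forall n, ((Num.sqrt (Num.max 0 (1 - n%:R * beta ^+ d)))%:E <= edet lam d n)%E) &
        (forall eps, 0 < eps < 1 -> forall n, achievable lam d n eps ->
           beta ^- d * (1 - eps) ^+ 2 <= n%:R)].

Definition zeta (s : R) : R := limn (fun n => \sum_(1 <= k < n) (k%:R `^ (- s))).

Definition korobov (r b0 b1 : R) (k : nat) : R :=
  if k is k'.+1 then Num.sqrt b1 * (k%:R `^ (- r)) else Num.sqrt b0.

End Defs.

Arguments psi1 {R}. Arguments psi {R}. Arguments boxsum {R}. Arguments sq_summable {R}.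
Arguments l2sq {R}. Arguments represents {R}. Arguments inH {R}. Arguments Hnorm {R}.
Arguments Hball {R}. Arguments cont_lin_functional {R}. Arguments torus {R}.
Arguments dbox {R}. Arguments lnull {R}. Arguments esssupT {R}. Arguments measT {R}.
Arguments method {R}. Arguments err {R}. Arguments edet {R}. Arguments init_err {R}.
Arguments achievable {R}. Arguments betaOf {R}. Arguments conclusions {R}.
Arguments zeta {R}. Arguments korobov {R}.

(* Main.v *)
(** Proof. Everything happens in the space of trigonometric polynomials with
    frequencies in the box [-K, K]^d, and integrals over the torus are replaced
    by averages over the grid of mesh [1 / (2 K + 1)], on which the basis
    [psi_k] is still orthogonal, with mean squares [w_k <= beta ^ d].

    If [P] is the orthogonal projector of the coefficient space onto the kernel
    of the information map, then [(psi(x), P psi(x))] is the square of the largest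
    value at [x] of a function in the unit ball with vanishing information.
    Its mean over the grid is [\tr (P W)], where [W = diag(w_k)]; since the trace
    of [1 - P] is at most [n], it is at least [\tr W - n beta ^ d], and
    [\tr W = (sum_(k <= K) lam_k ^ 2) ^ d] tends to 1 with [K]. A function [f]
    attaining this value is not distinguished from [- f] by the method, and [f] is
    continuous, so its value at one point bounds the essential supremum of one of the
    two errors from below. *)

Require Import Defs.
From HB Require Import structures.
From mathcomp Require Import all_boot all_order all_algebra.
From mathcomp Require Import all_classical all_reals all_analysis.
From mathcomp Require Import measurable_realfun lra ring zify.
Import Order.TTheory GRing.Theory Num.Theory.
Import numFieldNormedType.Exports.
Local Open Scope classical_set_scope.
Local Open Scope ring_scope.

(** * Boxes and null sets *)

(* The weights [w] make the induction on [d] go through: fixing one coordinate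
   to [t] multiplies them by the indicators of the intervals containing [t], and
   the resulting bound is integrated in [t]. *)
Lemma box_volume_le (R : realType) d (u v : 'I_d -> R) (a b : nat -> 'I_d -> R)
    (w : nat -> R) :
  (forall j, u j <= v j) -> (forall i j, a i j <= b i j) ->
  (forall i, 0 <= w i) ->
  (forall x, dbox _ u v x ->
    (1 <= \sum_(0 <= i <oo) (w i * \prod_j \1_(`[a i j, b i j]%classic) (x j))%:E)%E) ->
  ((\prod_j (v j - u j))%:E <=
     \sum_(0 <= i <oo) (w i * \prod_j (b i j - a i j))%:E)%E.
Proof.
elim: d u v a b w => [|d IH] u v a b w uv ab w0 cover.
  (* In dimension 0 the products are empty, and the covering hypothesis at the only point is the
     claim. *)
  have := cover (fun=> 0) (fun j => False_ind _ (notF (ltn_ord j))).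
  rewrite big_ord0; under eq_eseriesr do rewrite big_ord0.
  by under [X in _ -> (_ <= X)%E]eq_eseriesr do rewrite big_ord0.
pose mu := @lebesgue_measure R.
pose D : set R := `[u ord0, v ord0]%classic.
pose I i : set R := `[a i ord0, b i ord0]%classic.
pose V := \prod_j (v (lift ord0 j) - u (lift ord0 j)).
pose W i := w i * \prod_j (b i (lift ord0 j) - a i (lift ord0 j)).
have W0 i : 0 <= W i.
  by rewrite mulr_ge0// prodr_ge0// => j _; rewrite subr_ge0.
have V0 : 0 <= V by rewrite prodr_ge0// => j _; rewrite subr_ge0.
have mD : measurable D by exact: measurable_itv.
have mI i : measurable (I i) by exact: measurable_itv.
have slice t : D t -> (V%:E <= \sum_(0 <= i <oo) (W i * \1_(I i) t)%:E)%E.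
  move=> Dt.
  have -> : (\sum_(0 <= i <oo) (W i * \1_(I i) t)%:E =
      \sum_(0 <= i <oo) (w i * \1_(I i) t *
        \prod_j (b i (lift ord0 j) - a i (lift ord0 j)))%:E)%E.
    by apply: eq_eseriesr => i _; rewrite /W mulrAC.
  apply: (IH (u \o lift ord0) (v \o lift ord0) (fun i => a i \o lift ord0)
    (fun i => b i \o lift ord0)) => //= [i|x xB]; first by rewrite mulr_ge0.
  pose y j := if unlift ord0 j is Some k then x k else t.
  have yB : dbox _ u v y.
    move=> j; rewrite /y; case: unliftP => [k ->|->]; first exact: xB.
    by move: Dt; rewrite /D /= in_itv.
  have := cover y yB.
  under eq_eseriesr => i _.
    rewrite big_ord_recl mulrA {1}/y unlift_none.
    under eq_bigr => j _ do rewrite /y liftK.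
    over.
  by [].
rewrite big_ord_recl -/V mulrC.
have muD : mu D = (v ord0 - u ord0)%:E.
  rewrite /mu /D lebesgue_measure_itv /= lte_fin.
  case: ltP => [_|vu0]; first by rewrite EFinB.
  have -> : v ord0 = u ord0 by apply/le_anti; rewrite vu0 uv.
  by rewrite subrr.
rewrite EFinM -muD -(@integral_cst _ _ _ mu _ mD).
(* Integrating [slice] over [D] gives the volume on the left. Integrating the series term by term
   gives the measures of [I i] cut by [D], which are at most the side lengths of the boxes. *)
apply: (@le_trans _ _
  (\int[mu]_(t in D) \sum_(0 <= i <oo) (W i * \1_(I i) t)%:E)%E).
  apply: ge0_le_integral => //=.
  apply: ge0_emeasurable_sum => [k t Dt _|k _].
    by rewrite lee_fin mulr_ge0.
  apply/measurable_EFinP; apply: measurable_funM => //; apply: measurable_indic; exact: mI.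
rewrite integral_nneseries//; last 2 first.
- move=> k; apply/measurable_EFinP; apply: measurable_funM => //.
  by apply: measurable_indic; exact: mI.
- by move=> k t Dt; rewrite lee_fin mulr_ge0.
apply: lee_nneseries => [i _ _|i _].
  by apply: integral_ge0 => t Dt; rewrite lee_fin mulr_ge0.
under eq_integral do rewrite EFinM.
rewrite ge0_integralZl ?lee_fin//; last first.
  by apply/measurable_EFinP; apply: measurable_indic; exact: mI.
rewrite [X in (_ * X)%E](_ : _ = mu (I i `&` D)); last first.
  by apply: integral_indic => //; exact: mI.
rewrite big_ord_recl mulrCA mulrC -[w i * _]/(W i) [leRHS]EFinM.
apply: lee_pmul; rewrite ?lee_fin//.
apply: (@le_trans _ _ (mu (I i))).
  by apply: measureIl => //; exact: mI.
rewrite /mu /I lebesgue_measure_itv /= lte_fin.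
case: ifP => _; rewrite ?EFinB// lee_fin subr_ge0; exact: ab.
Qed.

(** A cover of total volume at most half that of the cube would contradict [box_volume_le] with unit
    weights. *)
Lemma cube_not_lnull (R : realType) d (N : set ('I_d -> R)) (u : 'I_d -> R) (s : R) :
  0 < s -> dbox _ u (fun j => u j + s) `<=` N -> ~ lnull d N.
Proof.
move=> s0 cubeN nullN.
have sd0 : 0 < s ^+ d / 2 by rewrite divr_gt0// exprn_gt0.
have [a [b [ab NB volB]]] := nullN _ sd0.
have vol_cube : \prod_(j < d) (u j + s - u j) = s ^+ d.
  by under eq_bigr do rewrite addrC addKr; rewrite prodr_const card_ord.
suff : ((s ^+ d)%:E <= (s ^+ d / 2)%:E)%E.
  rewrite lee_fin; apply/negP; rewrite -ltNge ltr_pdivrMr// ltr_pMr ?exprn_gt0//.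
  by rewrite ltr1n.
rewrite -{1}vol_cube.
apply: le_trans (@box_volume_le _ _ u (fun j => u j + s) a b (fun=> 1) _ ab _ _) _ => //=.
- by move=> j; rewrite lerDl ltW.
- move=> x /cubeN /NB [i _ xi].
  under eq_eseriesr do rewrite mul1r.
  (* The box containing [x] contributes 1, and all other terms are nonnegative. *)
  rewrite (nneseries_split 0 i.+1); last first.
    by move=> k _; rewrite lee_fin prodr_ge0.
  apply: (@le_trans _ _ (\sum_(0 <= k < 0 + i.+1)
      (\prod_j \1_(`[a k j, b k j]%classic) (x j))%:E)%E); last first.
    by rewrite leeDl// nneseries_ge0// => k _ _; rewrite lee_fin prodr_ge0.
  rewrite add0n big_nat_recr//= [X in (_ + X)%E](_ : _ = 1%E); last first.
    rewrite big1// => j _; rewrite indicE mem_set//=.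
    by rewrite in_itv /=; exact: xi.
  by rewrite leeDr// sume_ge0// => k _; rewrite lee_fin prodr_ge0.
- apply: lime_le; first by apply: is_cvg_nneseries => k _ _;
    rewrite lee_fin mul1r prodr_ge0// => j _; rewrite subr_ge0.
  near=> n; rewrite sumEFin; under eq_bigr do rewrite mul1r.
  rewrite lee_fin big_mkord; exact: volB.
Unshelve. all: by end_near. Qed.

Lemma lnullS (R : realType) d (A B : set ('I_d -> R)) :
  A `<=` B -> lnull d B -> lnull d A.
Proof.
move=> AB nullB e e0; have [a [b [ab Bab vol]]] := nullB e e0.
by exists a, b; split=> //; exact: subset_trans Bab.
Qed.

(** Positivity of [d] enters because a box in dimension 0 has volume 1, an empty product; otherwise
    a single point has volume 0. *)
Lemma lnull_set0 (R : realType) d : (0 < d)%N -> lnull d (set0 : set ('I_d -> R)).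
Proof.
move=> d0 e e0; exists (fun _ _ => 0), (fun _ _ => 0); split=> // n.
rewrite big1 ?ltW// => i _; rewrite (bigD1 (Ordinal d0))//= subrr mul0r//.
Qed.

(** The two covers, each of volume at most [e / 2], are interleaved over even and odd indices. *)
Lemma lnullU (R : realType) d (A B : set ('I_d -> R)) :
  lnull d A -> lnull d B -> lnull d (A `|` B).
Proof.
move=> nullA nullB e e0; have e20 : 0 < e / 2 by rewrite divr_gt0.
have [a [b [ab Aab vola]]] := nullA _ e20.
have [a' [b' [ab' Bab volb]]] := nullB _ e20.
exists (fun i => if odd i then a' i./2 else a i./2),
       (fun i => if odd i then b' i./2 else b i./2); split.
- by move=> i j; case: ifP.
- move=> x [/Aab[i _ xi]|/Bab[i _ xi]].
    by exists i.*2 => //; rewrite odd_double doubleK.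
  by exists i.*2.+1 => //=; rewrite odd_double /= uphalf_double.
move=> n.
pose F i := \prod_(j < d) ((if odd i then b' i./2 else b i./2) j -
                           (if odd i then a' i./2 else a i./2) j).
have F0 i : 0 <= F i by apply: prodr_ge0 => j _; rewrite subr_ge0; case: ifP.
(* Passing to [n.*2] terms makes both covers contribute exactly [n] boxes. *)
apply: (@le_trans _ _ (\sum_(i < n.*2) F i)).
  rewrite -!(big_mkord xpredT F) (@big_cat_nat _ _ _ n 0 n.*2)//=; last first.
    by rewrite -addnn leq_addr.
  by rewrite lerDl sumr_ge0.
have -> : \sum_(i < n.*2) F i = \sum_(i < n) \prod_(j < d) (b i j - a i j) +
    \sum_(i < n) \prod_(j < d) (b' i j - a' i j).
  elim: n => [|n IH]; first by rewrite !big_ord0 addr0.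
  rewrite doubleS !big_ord_recr /= IH /F /= odd_double /= doubleK uphalf_double.
  by rewrite -!addrA; congr (_ + _); rewrite addrCA.
by rewrite (splitr e) lerD.
Qed.

(** * Orthogonality on the grid *)

Lemma sum_cos_grid (R : realType) (M p : nat) (a : R) :
  (0 < p < M)%N ->
  \sum_(m < M) cos (a + 2 * pi * p%:R * (m%:R / M%:R)) = 0.
Proof.
move=> /andP[p0 pM].
have M0 : M%:R != 0 :> R by rewrite pnatr_eq0 -lt0n (leq_ltn_trans _ pM).
pose h : R := pi * p%:R / M%:R.
have sh : sin h != 0.
  (* Here [0 < h < pi] because [0 < p < M]. *)
  rewrite gt_eqF// sin_gt0_pi// /h; apply/andP; split.
    by rewrite divr_gt0 ?mulr_gt0 ?pi_gt0 ?ltr0n// (leq_ltn_trans _ pM).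
  rewrite ltr_pdivrMr ?ltr0n ?(leq_ltn_trans _ pM)// ltr_pM2l ?pi_gt0//.
  by rewrite ltr_nat.
(* [2 sin h cos x = sin (x + h) - sin (x - h)] makes the sum telescope. *)
apply: (mulfI sh); rewrite mulr0 mulr_sumr.
pose F m : R := sin (a + (m%:R *+ 2 - 1) * h) / 2.
rewrite (eq_bigr (fun m : 'I_M => F m.+1 - F m)) => [|m _].
  rewrite -(big_mkord xpredT (fun m => F m.+1 - F m)) telescope_sumr// /F.
  (* The two ends of the telescoped sum differ by [p] full periods. *)
  have -> : a + (M%:R *+ 2 - 1) * h = a + (0%:R *+ 2 - 1) * h + (p%:R * pi) *+ 2.
    by rewrite /h; field.
  have per k (x : R) : sin (x + (k%:R * pi) *+ 2) = sin x.
    elim: k => [|k IH]; first by rewrite mul0r mul0rn addr0.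
    by rewrite -natr1 mulrDl mul1r mulrnDl addrA [pi *+ 2]mulr2n addrA !sinDpi opprK IH.
  by rewrite per subrr.
have -> : a + 2 * pi * p%:R * (m%:R / M%:R) = a + (m%:R *+ 2) * h.
  by rewrite /h; field.
have -> : F m.+1 = sin (a + (m%:R *+ 2) * h + h) / 2.
  by rewrite /F; congr (sin _ / 2); rewrite -natr1; ring.
have -> : F m = sin (a + (m%:R *+ 2) * h - h) / 2.
  by rewrite /F; congr (sin _ / 2); ring.
by rewrite sinD sinB; field.
Qed.

Lemma sum_cos_grid_int (R : realType) (M : nat) (p : int) (a : R) :
  p != 0 -> (`|p| < M)%N ->
  \sum_(m < M) cos (a + 2 * pi * p%:~R * (m%:R / M%:R)) = 0.
Proof.
case: p => [p|p] p0 pM.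
  by apply: sum_cos_grid; rewrite pM lt0n -eqz_nat p0.
rewrite -[RHS](@sum_cos_grid R M p.+1 (- a) pM); apply: eq_bigr => m _.
by rewrite -[LHS]cosN; congr cos; rewrite NegzE mulrNz -pmulrn; ring.
Qed.

(** The mean square of [psi1 lam k] over a grid of [K.*2.+1] points with [|k| <= K]: squared sines
    and cosines average to 1/2, the constant to 1. *)
Definition grid_weight {R : realType} (lam : nat -> R) (k : int) : R :=
  if k == 0 then lam 0%N ^+ 2 else lam `|k|%N ^+ 2 / 2.

(** Turns sines into shifted cosines, so that a single product formula treats all signs of the
    frequencies. *)
Definition phase {R : realType} (k : int) : R := if k < 0 then - (pi / 2) else 0.

Lemma psi1_cos (R : realType) (lam : nat -> R) (k : int) (t : R) :
  psi1 lam k t = lam `|k|%N * cos (phase k + 2 * pi * `|k|%N%:R * t).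
Proof.
case: k => [[|k]|k]; rewrite /phase /=.
- by rewrite mulr0 mul0r addr0 cos0 mulr1.
- by rewrite add0r.
- by rewrite addrC -sinDpihalf subrK.
Qed.

(** The product formula for cosines leaves frequencies [|k| + |l|] and [|k| - |l|], of size at most
    [2 K < M]. Hence there is no aliasing, and only zero frequencies survive summation. *)
Lemma psi1_grid_orthogonal (R : realType) (lam : nat -> R) (K : nat) (k l : int) :
  (`|k| <= K)%N -> (`|l| <= K)%N ->
  \sum_(m < K.*2.+1) psi1 lam k (m%:R / K.*2.+1%:R) * psi1 lam l (m%:R / K.*2.+1%:R) =
  if k == l then K.*2.+1%:R * grid_weight lam k else 0.
Proof.
move=> kK lK; set M := K.*2.+1.
pose A k l (m : 'I_M) : R :=
  cos ((phase k + phase l) + 2 * pi * (`|k|%N%:Z + `|l|%N%:Z)%:~R * (m%:R / M%:R)).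
pose B k l (m : 'I_M) : R :=
  cos ((phase k - phase l) + 2 * pi * (`|k|%N%:Z - `|l|%N%:Z)%:~R * (m%:R / M%:R)).
have E (m : 'I_M) : psi1 lam k (m%:R / M%:R) * psi1 lam l (m%:R / M%:R) =
    lam `|k|%N * lam `|l|%N / 2 * (A k l m + B k l m).
  rewrite !psi1_cos /A /B.
  set x := phase k + _; set y := phase l + _.
  have -> : (phase k + phase l) + 2 * pi * (`|k|%N%:Z + `|l|%N%:Z)%:~R * (m%:R / M%:R) = x + y.
    by rewrite /x /y intrD; ring.
  have -> : (phase k - phase l) + 2 * pi * (`|k|%N%:Z - `|l|%N%:Z)%:~R * (m%:R / M%:R) = x - y.
    by rewrite /x /y intrB; ring.
  by rewrite cosD cosB; field.
rewrite (eq_bigr _ (fun m _ => E m)) -mulr_sumr big_split /=.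
have SA : (k != 0) || (l != 0) -> \sum_m A k l m = 0.
  move=> kl0; apply: sum_cos_grid_int; rewrite -PoszD ?absz_nat /M; last by lia.
  by rewrite eqz_nat; lia.
have SB : `|k|%N != `|l|%N -> \sum_m B k l m = 0.
  by move=> kl; apply: sum_cos_grid_int; rewrite /M; lia.
have SB' : `|k|%N = `|l|%N -> \sum_m B k l m = M%:R * cos (phase k - phase l).
  move=> kl; rewrite /B kl subrr; under eq_bigr do rewrite mulr0 mul0r addr0.
  by rewrite sumr_const card_ord mulr_natl.
have [kl|kl] := eqVneq k l.
  subst l; rewrite SB'// subrr cos0 /grid_weight.
  have [k0|k0] := eqVneq k 0; last by rewrite SA ?k0//; field.
  rewrite (eq_bigr (fun=> 1)) => [|m _]; last first.
    by rewrite /A k0 /phase /= !addr0 mulr0z mulr0 mul0r addr0 cos0.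
  by rewrite sumr_const card_ord k0; field.
have [kl'|kl'] := eqVneq `|k|%N `|l|%N; last first.
  by rewrite SA ?SB ?addr0 ?mulr0//; lia.
rewrite SA ?SB'// ?add0r; last by lia.
(* What remains is a sine against a cosine of equal frequency; their phases differ by [pi / 2]. *)
have [[k0 l0]|[k0 l0]] : (k < 0 /\ 0 <= l) \/ (0 <= k /\ l < 0) by lia.
- by rewrite /phase k0 ltNge l0 subr0 cosN cos_pihalf !mulr0.
- by rewrite /phase l0 ltNge k0 sub0r opprK cos_pihalf !mulr0.
Qed.

(** * A large value in a subspace of small codimension *)

Lemma mulmx_tr_eq0 (R : realDomainType) m n (A : 'M[R]_(m, n)) :
  A *m A^T = 0 -> A = 0.
Proof.
move=> AA0; apply/matrixP => i j; rewrite mxE; apply/eqP.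
have : (A *m A^T) i i = 0 by rewrite AA0 mxE.
rewrite mxE => /eqP; rewrite psumr_eq0 => [|k _]; last by rewrite mxE -expr2 sqr_ge0.
by move=> /allP /(_ j (mem_index_enum j)); rewrite mxE -expr2 sqrf_eq0.
Qed.

Lemma gram_unit (R : realFieldType) m n (B : 'M[R]_(m, n)) :
  row_free B -> B *m B^T \in unitmx.
Proof.
move=> freeB; rewrite -row_free_unit -kermx_eq0; set Z := kermx _.
have : (Z *m B) *m (Z *m B)^T = 0.
  by rewrite trmx_mul mulmxA -(mulmxA Z) mulmx_ker mul0mx.
by move=> /mulmx_tr_eq0 ZB0; rewrite -(mulmx_free_eq0 _ freeB) ZB0.
Qed.

(** With the rows of [B] a basis of the left kernel of [A], the projector is [B^T (B B^T)^-1 B]; by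
    cyclicity its trace is the dimension of that kernel. *)
Lemma orthogonal_projector_ker (R : realFieldType) m n (A : 'M[R]_(m, n)) :
  exists P : 'M[R]_m, [/\ P^T = P, P *m P = P, P *m A = 0 & m%:R - n%:R <= \tr P].
Proof.
pose B := row_base (kermx A); set r := \rank (kermx A) in B.
have freeB : row_free B by exact: row_base_free.
have BA : B *m A = 0 by apply/sub_kermxP; rewrite eq_row_base.
clearbody B.
have uG : B *m B^T \in unitmx by exact: gram_unit.
pose G := invmx (B *m B^T).
have GT : G^T = G by rewrite /G trmx_inv trmx_mul trmxK.
exists (B^T *m G *m B); split.
- by rewrite !trmx_mul trmxK GT mulmxA.
- by rewrite !mulmxA -(mulmxA _ B B^T) -(mulmxA _ G (B *m B^T)) (mulVmx uG) mulmx1.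
- by rewrite -(mulmxA _ B A) BA mulmx0.
- rewrite -mulmxA mxtrace_mulC -mulmxA (mulVmx uG) mxtrace1.
  rewrite lerBlDr -natrD ler_nat /r mxrank_ker addnC -leq_subLR leq_sub2l//.
  exact: rank_leq_col.
Qed.

Lemma sum_sqr_mulmx (R : comPzRingType) m (v : 'rV[R]_m) :
  \sum_i v 0 i ^+ 2 = (v *m v^T) 0 0.
Proof. by rewrite mxE; apply: eq_bigr => i _; rewrite [v^T _ _]mxE expr2. Qed.

(* For [P] the orthogonal projector onto the kernel of [A], the squared
   distances [(Psi^T P Psi) x x] sum to [\tr (P W) = \tr W - \tr ((1 - P) W)],
   and the last trace is at most [beta \tr (1 - P) <= n beta]. *)
Lemma kernel_vector_large_entry (R : realType) D n G (A : 'M[R]_(D, n))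
    (Psi : 'M[R]_(D, G)) (w : 'rV[R]_D) (beta q : R) :
  Psi *m Psi^T = diag_mx w -> (forall i, w 0 i <= beta) -> 0 <= beta -> 0 < q ->
  (0 < G)%N -> G%:R * q <= \sum_i w 0 i - n%:R * beta ->
  exists (x : 'I_G) (c : 'rV[R]_D),
    [/\ c *m A = 0, \sum_i c 0 i ^+ 2 = 1 & Num.sqrt q <= (c *m Psi) 0 x].
Proof.
move=> PsiW wb b0 q0 G0 qle.
have [P [PT PP PA trP]] := orthogonal_projector_ker _ _ _ A.
(* Being of the form [Q Q^T], the complementary projector has a nonnegative diagonal, so the weights
   can be replaced by [beta] in its trace. *)
have QE : (1%:M - P) *m (1%:M - P)^T = 1%:M - P.
  rewrite linearB /= trmx1 PT mulmxBr mulmx1 mulmxBl mul1mx PP subrr subr0//.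
have Q0 i : 0 <= (1%:M - P) i i.
  by rewrite -QE [leRHS]mxE sumr_ge0// => k _; rewrite [X in _ * X]mxE -expr2 sqr_ge0.
have trPW : \sum_i w 0 i - n%:R * beta <= \tr (P *m diag_mx w).
  have -> : P *m diag_mx w = diag_mx w - (1%:M - P) *m diag_mx w.
    by rewrite mulmxBl mul1mx opprB addrC subrK.
  rewrite raddfB /= mxtrace_diag lerB//.
  apply: (@le_trans _ _ (\tr (1%:M - P) * beta)).
    rewrite /mxtrace mulr_suml ler_sum// => i _.
    by rewrite mul_mx_diag mxE ler_wpM2l.
  by rewrite ler_wpM2r// raddfB /= mxtrace1 lerBlDl -lerBlDr.
pose t x := (Psi^T *m P *m Psi) x x.
(* If every [t x] were below [q], their sum, which is [\tr (P W)], would be below [G%:R * q]. *)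
have [x tx] : exists x, q <= t x.
  apply/not_existsP => tq.
  have : \sum_x t x < \sum_(x < G) q.
    apply: ltr_sum => [|x _]; last by rewrite ltNge; apply/negP.
    by apply/hasP; exists (Ordinal G0); rewrite ?mem_index_enum.
  rewrite sumr_const card_ord -[_ *+ _]mulr_natl; apply/negP; rewrite -leNgt.
  apply: (le_trans qle); apply: (le_trans trPW).
  by rewrite -PsiW mulmxA mxtrace_mulC mulmxA.
have t0 : 0 < t x := lt_le_trans q0 tx.
(* The projection of the evaluation vector at [x] onto the kernel. Its squared norm and its value at
   [x] both equal [t x], so normalising it yields the value [Num.sqrt (t x)]. *)
pose v := (col x Psi)^T *m P.
have vv : \sum_i v 0 i ^+ 2 = t x.
  rewrite sum_sqr_mulmx /v trmx_mul trmxK PT mulmxA -(mulmxA _ P P) PP /t.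
  by rewrite tr_col -row_mul !mxE; apply: eq_bigr => i _; rewrite !mxE.
have vx : (v *m Psi) 0 x = t x.
  by rewrite /v tr_col -!row_mul mxE.
have st0 : Num.sqrt (t x) != 0 by rewrite gt_eqF// sqrtr_gt0.
exists x, ((Num.sqrt (t x))^-1 *: v); split.
- by rewrite -scalemxAl /v -mulmxA PA mulmx0 scaler0.
- under eq_bigr do rewrite mxE exprMn.
  by rewrite -mulr_sumr vv exprVn sqr_sqrtr ?ltW// mulVf// gt_eqF.
- rewrite -scalemxAl mxE vx -{2}(sqr_sqrtr (ltW t0)) expr2 mulKf//.
  exact: ler_wsqrtr.
Qed.

(** * Trigonometric polynomials *)

Section TrigPolynomials.
Variables (R : realType) (lam : nat -> R) (d K : nat).

Local Notation box K := {ffun 'I_d -> 'I_(K.*2.+1)}.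

Definition freq {K} (m : box K) : 'I_d -> int := fun j => (nat_of_ord (m j))%:Z - K%:Z.

Definition unfreq L (k : 'I_d -> int) : box L := [ffun j => inord (absz (k j + L%:Z))].

Definition inbox L (k : 'I_d -> int) := [forall j, (`|k j| <= L)%N].

Lemma freqK L : cancel (@freq L) (unfreq L).
Proof.
move=> m; apply/ffunP => j; rewrite ffunE /freq subrK absz_nat.
by apply: val_inj; rewrite /= inordK.
Qed.

Lemma unfreqK L k : inbox L k -> freq (unfreq L k) = k.
Proof.
move=> /forallP kL; apply/funext => j; rewrite /freq ffunE.
by have kj := kL j; rewrite inordK; lia.
Qed.

Lemma inbox_freq L (m : box L) : inbox L (freq m).
Proof. by apply/forallP => j; have := ltn_ord (m j); rewrite /freq; lia. Qed.

Lemma inboxW L L' k : (L <= L')%N -> inbox L k -> inbox L' k.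
Proof. by move=> LL' /forallP kL; apply/forallP => j; apply: leq_trans LL'. Qed.

(** Boxes of different sizes are different index types; this makes their sums comparable. *)
Lemma boxsum_split L L' (F : ('I_d -> int) -> R) : (L <= L')%N ->
  boxsum d L' F = boxsum d L F + \sum_(m : box L' | ~~ inbox L (freq m)) F (freq m).
Proof.
move=> LL'; rewrite [LHS](bigID (fun m : box L' => inbox L (freq m))) /=; congr (_ + _).
rewrite (reindex_onto (fun m : box L => unfreq L' (freq m)) (fun m => unfreq L (freq m))) /=.
  apply: eq_big => [m|m _]; rewrite -/(freq _) unfreqK ?inbox_freq ?freqK ?eqxx//;
    exact: (inboxW _ _ _ LL' (inbox_freq _ m)).
by move=> m mL; rewrite unfreqK// freqK.
Qed.

Definition ext (u : box K -> R) (k : 'I_d -> int) : R :=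
  if inbox K k then u (unfreq K k) else 0.

Definition trig (u : box K -> R) (x : 'I_d -> R) : R :=
  \sum_m u m * psi lam d (freq m) x.

Lemma ext_freq u m : ext u (freq m) = u m.
Proof. by rewrite /ext inbox_freq freqK. Qed.

Lemma boxsum_ext u (F : R -> ('I_d -> int) -> R) L : (forall k, F 0 k = 0) ->
  (K <= L)%N -> boxsum d L (fun k => F (ext u k) k) = \sum_m F (u m) (freq m).
Proof.
move=> F0 KL; rewrite (boxsum_split K)// [X in _ + X]big1 => [|m mK]; last first.
  by rewrite /ext (negbTE mK) F0.
by rewrite addr0; apply: eq_bigr => m _; rewrite -/(freq m) ext_freq.
Qed.

Lemma boxsum_sqr_ext u L : boxsum d L (fun k => ext u k ^+ 2) <= \sum_m u m ^+ 2.
Proof.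
have E L' : (K <= L')%N -> boxsum d L' (fun k => ext u k ^+ 2) = \sum_m u m ^+ 2.
  by move=> KL; rewrite (boxsum_ext u (fun y _ => y ^+ 2))// => k; rewrite expr0n.
have [/E->//|LK] := leqP K L.
have -> : \sum_m u m ^+ 2 = boxsum d K (fun k => ext u k ^+ 2) by rewrite E.
rewrite [leRHS](boxsum_split L K _ (ltnW LK)) lerDl.
by apply: sumr_ge0 => m _; exact: sqr_ge0.
Qed.

Lemma trig_represents u : represents lam d (ext u) (trig u).
Proof.
split; first by exists (\sum_m u m ^+ 2) => L; exact: boxsum_sqr_ext.
move=> x; apply: cvg_near_cst; exists K => // L /= KL.
by rewrite (boxsum_ext u (fun y k => y * psi lam d k x))// => k; rewrite mul0r.
Qed.

Lemma trig_inH u : inH lam d (trig u).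
Proof. by exists (ext u); exact: trig_represents. Qed.

(** [Hnorm] is an infimum over representing families, so the single family [ext u] already bounds it
    from above. *)
Lemma trig_Hball u : \sum_m u m ^+ 2 <= 1 -> Hball lam d (trig u).
Proof.
move=> u1; split; first exact: trig_inH.
apply: (@le_trans _ _ (Num.sqrt (l2sq d (ext u)))).
  apply: ge_inf; last by exists (ext u) => //; exact: trig_represents.
  by exists 0 => _ [c _ <-]; exact: sqrtr_ge0.
rewrite -[leRHS]sqrtr1 ler_wsqrtr//; apply: ge_sup; first by exists
  (boxsum d 0 (fun k => ext u k ^+ 2)), 0%N.
by move=> _ [L _ <-]; apply: le_trans (boxsum_sqr_ext u L) u1.
Qed.

Lemma trigZD u v (a b : R) :
  trig (fun m => a * u m + b * v m) = (fun x => a * trig u x + b * trig v x).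
Proof.
apply/funext => x; rewrite /trig !mulr_sumr -big_split /=.
by apply: eq_bigr => m _; rewrite mulrDl !mulrA.
Qed.

Lemma trigN u x : trig (fun m => - u m) x = - trig u x.
Proof. by rewrite /trig -sumrN; apply: eq_bigr => m _; rewrite mulNr. Qed.

Lemma functional_trig L u : cont_lin_functional lam d L ->
  L (trig u) = \sum_m u m * L (trig (fun m' => (m == m')%:R)).
Proof.
move=> [linL _].
have LZD v w (a b : R) : L (trig (fun m => a * v m + b * w m)) =
      a * L (trig v) + b * L (trig w).
  by rewrite trigZD linL//; exact: trig_inH.
have Ls (s : seq (box K)) : L (trig (fun m => \sum_(m' <- s) u m' * (m' == m)%:R)) =
    \sum_(m' <- s) u m' * L (trig (fun m => (m' == m)%:R)).
  elim: s => [|m' s IH].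
    (* Linearity is given for combinations of two functions, so zero is written as one with zero
       coefficients. *)
    rewrite big_nil (_ : (fun m => _) = (fun m => 0 * u m + 0 * u m)).
      by rewrite LZD !mul0r addr0.
    by apply/funext => m; rewrite big_nil !mul0r addr0.
  rewrite big_cons -IH -[X in _ + X]mul1r -LZD; congr (L (trig _)).
  by apply/funext => m; rewrite big_cons mul1r.
rewrite -Ls; congr (L (trig _)); apply/funext => m.
rewrite (bigD1 m)//= eqxx mulr1 big1 ?addr0// => m' /negbTE->; exact: mulr0.
Qed.

End TrigPolynomials.

Arguments trig {R} lam {d K}. Arguments freq {d K}. Arguments ext {R d K}.
Arguments functional_trig {R lam d K L}.

(** * Sums over frequency boxes *)

Lemma sum_symmetric (R : comPzRingType) (g : int -> R) K :
  \sum_(i < K.*2.+1) g ((i : nat)%:Z - K%:Z) =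
  g 0 + \sum_(k < K) (g k.+1%:Z + g (- k.+1%:Z)).
Proof.
elim: K => [|K IH]; first by rewrite big_ord_recl !big_ord0 subrr.
rewrite doubleS big_ord_recl big_ord_recr /= [in RHS]big_ord_recr /= [RHS]addrA -IH.
rewrite addrCA (addrC (g _)); congr (_ + (g _ + g _)); last by lia.
  by apply: eq_bigr => i _; congr g; rewrite /bump /=; lia.
by rewrite /bump /=; lia.
Qed.

Lemma boxsum_prod (R : realType) d K (g : 'I_d -> int -> R) :
  boxsum d K (fun k => \prod_j g j (k j)) =
  \prod_j \sum_(i < K.*2.+1) g j ((i : nat)%:Z - K%:Z).
Proof. by rewrite bigA_distr_bigA. Qed.

Lemma sum_grid_weight (R : realType) (lam : nat -> R) K :
  \sum_(i < K.*2.+1) grid_weight lam ((i : nat)%:Z - K%:Z) =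
  \sum_(0 <= k < K.+1) lam k ^+ 2.
Proof.
rewrite (sum_symmetric _ (grid_weight lam)) big_nat_recl// big_mkord; congr (_ + _).
by apply: eq_bigr => k _; rewrite /grid_weight /=; field.
Qed.

Lemma sum_psi1_sqr (R : realType) (lam : nat -> R) K t :
  \sum_(i < K.*2.+1) psi1 lam ((i : nat)%:Z - K%:Z) t ^+ 2 =
  \sum_(0 <= k < K.+1) lam k ^+ 2.
Proof.
rewrite (sum_symmetric _ (fun k => psi1 lam k t ^+ 2)) big_nat_recl// big_mkord.
congr (_ + _); apply: eq_bigr => k _; rewrite /= !exprMn -mulrDr cos2Dsin2 mulr1//.
Qed.

(** Cauchy-Schwarz, from expanding the squared norm of [a - C b] with [C] the inner product. *)
Lemma sqr_sum_mul_le (R : realDomainType) (I : finType) (a b : I -> R) :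
  \sum_i b i ^+ 2 <= 1 -> (\sum_i a i * b i) ^+ 2 <= \sum_i a i ^+ 2.
Proof.
set C := \sum_i a i * b i => b1.
have : 0 <= \sum_i (a i - C * b i) ^+ 2 by apply: sumr_ge0 => i _; exact: sqr_ge0.
have -> : \sum_i (a i - C * b i) ^+ 2 =
    \sum_i a i ^+ 2 - C ^+ 2 *+ 2 + C ^+ 2 * \sum_i b i ^+ 2.
  rewrite (eq_bigr (fun i => a i ^+ 2 + (- (C *+ 2) * (a i * b i) + C ^+ 2 * b i ^+ 2))).
    by rewrite !big_split /= -!mulr_sumr -/C; ring.
  by move=> i _; ring.
have : C ^+ 2 * \sum_i b i ^+ 2 <= C ^+ 2 by rewrite ler_piMr// sqr_ge0.
by lra.
Qed.

(** * Essential suprema of trigonometric polynomials *)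

Lemma esssupT_lt_lnull (R : realType) d (h : ('I_d -> R) -> R) (v : R) :
  (esssupT d h < v%:E)%E -> lnull d [set x | torus d x /\ v < `|h x|].
Proof.
move=> /ereal_inf_lt[_ [M nullM <-]]; rewrite lte_fin => Mv.
by apply: lnullS nullM => x [Tx vx]; split=> //; exact: lt_trans vx.
Qed.

Lemma trig_continuous (R : realType) (lam : nat -> R) d K
    (u : {ffun 'I_d -> 'I_(K.*2.+1)} -> R) :
  continuous (fun y : 'rV[R]_d => trig lam u (fun j => y 0 j)).
Proof.
apply: continuous_big => [|m _]; first exact: add_continuous.
move=> y; apply: (@cvgM _ _ (nbhs y) _ (fun=> u m)
  (fun y : 'rV[R]_d => psi lam d (freq m) (fun j => y 0 j))); first exact: cvg_cst.
move: y; apply: continuous_big => [|j _]; first exact: mul_continuous.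
rewrite (_ : (fun _ => _) =
  (fun y : 'rV[R]_d => lam `|freq m j|%N *
    cos (phase (freq m j) + 2 * pi * `|freq m j|%N%:R * y 0 j))).
  move=> z; apply: (@cvgM _ _ (nbhs z) _ (fun=> _)); first exact: cvg_cst.
  apply: (@continuous_comp _ _ _ (fun y : 'rV[R]_d => _ + _ * y 0 j)).
    2: exact: continuous_cos.
  apply: (@cvgD _ _ _ (nbhs z) _ (fun=> _)); first exact: cvg_cst.
  apply: (@cvgM _ _ (nbhs z) _ (fun=> _)); first exact: cvg_cst.
  exact: coord_continuous.
by apply/funext => z; rewrite psi1_cos.
Qed.

Lemma trig_gt_not_lnull (R : realType) (lam : nat -> R) d K
    (u : {ffun 'I_d -> 'I_(K.*2.+1)} -> R) (x0 : 'I_d -> R) (v : R) :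
  torus d x0 -> v < `|trig lam u x0| ->
  ~ lnull d [set x | torus d x /\ v < `|trig lam u x|].
Proof.
move=> Tx0 vx0.
pose y0 : 'rV[R]_d := \row_j x0 j.
have yx : (fun j => y0 0 j) = x0 by apply/funext => j; rewrite mxE.
have : nbhs y0 [set y : 'rV[R]_d |
    (forall j, y 0 j < 1) /\ v < `|trig lam u (fun j => y 0 j)|].
  apply: filterI.
    apply: (@filter_forall _ _ (fun j => [set y : 'rV[R]_d | y 0 j < 1]) (nbhs y0)) => j.
    apply: (@cvgr_lt _ _ (nbhs y0) _ (fun y => y 0 j) (y0 0 j)).
      exact: coord_continuous.
    by rewrite mxE; have /andP[] := Tx0 j.
  apply: (@cvgr_gt _ _ (nbhs y0) _ (fun y : 'rV[R]_d => `|trig lam u (fun j => y 0 j)|)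
    `|trig lam u (fun j => y0 0 j)|); last by rewrite yx.
  apply: (@cvg_norm _ _ _ (nbhs y0) _ (fun y : 'rV[R]_d => trig lam u (fun j => y 0 j))).
  exact: trig_continuous.
move=> /nbhs_ballP[e /= e0 ball_e].
(* The cube has [x0] as its lowest corner, so its points keep nonnegative coordinates; the bound by
   1 comes from the neighbourhood. *)
apply: (@cube_not_lnull _ _ _ x0 (e / 2)); first by rewrite divr_gt0.
move=> x xbox.
have [|x1 vx] := ball_e (\row_j x j).
  split=> // i j; rewrite ord1 !mxE /ball /= ltr_distlC.
  by have := xbox j; lra.
have xE : (fun j => (\row_j x j) 0 j) = x by apply/funext => j; rewrite mxE.
rewrite xE in vx; split=> // j; have := x1 j; rewrite mxE => ->; rewrite andbT.
by have := xbox j; have := Tx0 j; lra.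
Qed.

(** * Pointwise bounds and hard functions *)

Lemma sum_enum_val (V : nmodType) (T : finType) (F : T -> V) :
  \sum_(i < #|T|) F (enum_val i) = \sum_t F t.
Proof. by rewrite [RHS](reindex (@enum_val T T))//; exact/onW_bij/enum_val_bij. Qed.

Lemma sum_sqr_le1 (R : realType) (lam : nat -> R) n :
  (fun n => \sum_(0 <= k < n) lam k ^+ 2) @ \oo --> (1 : R) ->
  \sum_(0 <= k < n) lam k ^+ 2 <= 1.
Proof.
move=> lam1; rewrite -(cvg_lim _ lam1)//.
apply: (nondecreasing_cvgn_le (u_ := fun n => \sum_(0 <= k < n) lam k ^+ 2)).
  apply/nondecreasing_seqP => m; rewrite big_nat_recr//= lerDl; exact: sqr_ge0.
by apply/cvg_ex; exists 1.
Qed.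

(** Cauchy-Schwarz on each box: the sum of the squares of [psi] at [x] is a truncation of the kernel
    on the diagonal, hence at most 1. *)
Lemma Hball_norm_le1 (R : realType) (lam : nat -> R) d f x :
  (fun n => \sum_(0 <= k < n) lam k ^+ 2) @ \oo --> (1 : R) ->
  Hball lam d f -> `|f x| <= 1.
Proof.
move=> lam1 [[c0 c0f] f1]; apply: le_trans f1.
apply: lb_le_inf; first by exists (Num.sqrt (l2sq d c0)), c0.
move=> _ [c [[M cM] cf] <-].
apply: (@cvgr_to_le _ \oo _ _
  (fun K => `|boxsum d K (fun k => c k * psi lam d k x)|) `|f x|).
  by apply: cvg_norm; exact: cf.
near=> K.
rewrite -sqrtr_sqr ler_wsqrtr//.
apply: (@le_trans _ _ (boxsum d K (fun k => c k ^+ 2))).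
  apply: sqr_sum_mul_le.
  have -> : \sum_(m : {ffun 'I_d -> 'I_(K.*2.+1)}) psi lam d (freq m) x ^+ 2 =
      boxsum d K (fun k => \prod_j psi1 lam (k j) (x j) ^+ 2).
    by apply: eq_bigr => m _; rewrite prodrXl.
  rewrite (boxsum_prod _ _ _ (fun j k => psi1 lam k (x j) ^+ 2)).
  apply: prodr_ile1 => j _; rewrite sum_psi1_sqr sum_sqr_le1// sumr_ge0// => k _.
  exact: sqr_ge0.
apply: ub_le_sup; last by exists K.
by exists M => _ [L _ <-].
Unshelve. all: by end_near. Qed.

(** The strict inequality on [v] leaves room to truncate the frequencies at a finite [K], after
    which [kernel_vector_large_entry] applies. *)
Lemma hard_function (R : realType) (lam : nat -> R) d n L (beta v : R) :
  (fun n => \sum_(0 <= k < n) lam k ^+ 2) @ \oo --> (1 : R) ->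
  (forall k, 0 <= grid_weight lam k <= beta) ->
  (forall i : 'I_n, cont_lin_functional lam d (L i)) ->
  v < Num.sqrt (Num.max 0 (1 - n%:R * beta ^+ d)) ->
  exists K (u : {ffun 'I_d -> 'I_(K.*2.+1)} -> R) x,
    [/\ torus d x, \sum_m u m ^+ 2 <= 1, forall i, L i (trig lam u) = 0 &
        v < `|trig lam u x|].
Proof.
move=> lam1 wbeta linL vlt.
(* For [v < 0] the radicand may be nonpositive, and the zero function is used. *)
have [v0|v0] := ltP v 0.
  exists 0%N, (fun=> 0), (fun=> 0); split=> [j|||].
  - by rewrite lexx ltr01.
  - by rewrite big1 ?ler01// => m _; rewrite expr0n.
  - by move=> i; rewrite (functional_trig _ (linL i)) big1// => m _; rewrite mul0r.
  - by apply: lt_le_trans v0 _; exact: normr_ge0.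
have beta0 : 0 <= beta by have /andP[] := wbeta 0; exact: le_trans.
have v2 : v ^+ 2 + n%:R * beta ^+ d < 1.
  have : v ^+ 2 < Num.sqrt (Num.max 0 (1 - n%:R * beta ^+ d)) ^+ 2.
    by rewrite ltr_pXn2r// nnegrE// sqrtr_ge0.
  by rewrite sqr_sqrtr ?le_max ?lexx// lt_max ltNge sqr_ge0 ltrBrDr.
pose kap K := \sum_(0 <= k < K.+1) lam k ^+ 2.
have [K Kv] : exists K, v ^+ 2 + n%:R * beta ^+ d < kap K ^+ d.
  have : (fun K => kap K ^+ d) @ \oo --> (1 : R).
    rewrite -[X in _ --> X](expr1n _ d).
    apply: (@continuous_cvg _ _ _ \oo _ kap (fun y : R => y ^+ d)); first exact: exprn_continuous.
    by rewrite -cvg_shiftS in lam1; exact: lam1.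
  move=> /cvgr_gt /(_ _ v2) [K _ HK]; exists K; exact: (HK K (leqnn K)).
set M := K.*2.+1.
pose box := {ffun 'I_d -> 'I_M}.
pose grid (t : box) (j : 'I_d) : R := (t j : nat)%:R / M%:R.
(* Rows are frequencies and columns grid points; both are indexed by [box], since there are [M] of
   each per coordinate. *)
pose Psi : 'M[R]_(#|box|, #|box|) :=
  \matrix_(i, t) psi lam d (freq (enum_val i)) (grid (enum_val t)).
pose w : 'rV[R]_#|box| :=
  \row_i (M%:R ^+ d * \prod_j grid_weight lam (freq (enum_val i) j)).
(* The product [c *m A] is the information about the polynomial with coefficients [c]. *)
pose A : 'M[R]_(#|box|, n) :=
  \matrix_(i, l) L l (trig lam (fun m => (enum_val i == m)%:R)).
pose q := kap K ^+ d - n%:R * beta ^+ d.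
have PsiE i t : Psi i t = psi lam d (freq (enum_val i)) (grid (enum_val t)).
  by rewrite mxE.
have PsiW : Psi *m Psi^T = diag_mx w.
  apply/matrixP => i i'; rewrite !mxE.
  rewrite (eq_bigr (fun t => psi lam d (freq (enum_val i)) (grid (enum_val t)) *
     psi lam d (freq (enum_val i')) (grid (enum_val t)))) => [|t _]; last first.
    by rewrite [Psi^T _ _]mxE !PsiE.
  rewrite (sum_enum_val _ _ (fun t => psi lam d (freq (enum_val i)) (grid t) *
     psi lam d (freq (enum_val i')) (grid t))).
  rewrite (eq_bigr (fun t : box => \prod_j (psi1 lam (freq (enum_val i) j) (grid t j) *
    psi1 lam (freq (enum_val i') j) (grid t j)))) => [|t _]; last by rewrite big_split.
  rewrite -(bigA_distr_bigA (fun j (s : 'I_M) =>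
    psi1 lam (freq (enum_val i) j) (s%:R / M%:R) *
    psi1 lam (freq (enum_val i') j) (s%:R / M%:R))).
  have fK (i0 : 'I_#|box|) j : (`|freq (enum_val i0) j| <= K)%N.
    by have /forallP := inbox_freq d K (enum_val i0).
  under eq_bigr => j _ do rewrite psi1_grid_orthogonal//.
  have [->|ii'] := eqVneq i i'.
    under eq_bigr do rewrite eqxx.
    by rewrite big_split /= prodr_const card_ord mulr1n.
  (* Distinct frequencies differ in some coordinate [j], whose factor vanishes. *)
  have [/forallP same|/forallPn[j jne]] :=
      boolP [forall j, freq (enum_val i) j == freq (enum_val i') j].
    case/eqP : ii'; apply: enum_val_inj; apply: (can_inj (freqK d K)).
    by apply/funext => j; apply/eqP.
  by rewrite mulr0n (bigD1 j)//= (negbTE jne) mul0r.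
have wle i : w 0 i <= M%:R ^+ d * beta ^+ d.
  rewrite mxE ler_wpM2l ?exprn_ge0//.
  rewrite -[in leRHS](card_ord d) -prodr_const; apply: ler_prod => j _; exact: wbeta.
have sumw : \sum_i w 0 i = M%:R ^+ d * kap K ^+ d.
  under eq_bigr do rewrite mxE.
  rewrite -mulr_sumr; congr (_ * _).
  rewrite (sum_enum_val _ _ (fun m : box => \prod_j grid_weight lam (freq m j))).
  rewrite -[LHS]/(boxsum d K (fun k => \prod_j grid_weight lam (k j))).
  rewrite (boxsum_prod _ _ _ (fun _ => grid_weight lam)) sum_grid_weight.
  by rewrite prodr_const card_ord.
have q0 : 0 < q by rewrite subr_gt0 (le_lt_trans _ Kv)// lerDr sqr_ge0.
have cardbox : (#|box|%:R : R) = M%:R ^+ d by rewrite card_ffun !card_ord natrX.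
(* The bound on [w] is [M%:R ^+ d * beta ^+ d], and the grid has [M ^ d] points, so this factor
   cancels from the trace condition. *)
have [|||x [c [cA c1 cx]]] := @kernel_vector_large_entry _ _ _ _ A Psi w _ q PsiW wle _ q0 _ _.
- by rewrite mulr_ge0// exprn_ge0.
- by rewrite card_ffun !card_ord expn_gt0.
- by rewrite sumw cardbox /q mulrBr mulrCA.
exists K, (fun m => c 0 (enum_rank m)), (grid (enum_val x)); split.
- move=> j; rewrite /grid divr_ge0//= ltr_pdivrMr ?ltr0n// mul1r ltr_nat.
  exact: ltn_ord.
- rewrite -(sum_enum_val _ _ (fun m => c 0 (enum_rank m) ^+ 2)).
  by under eq_bigr do rewrite enum_valK; rewrite c1.
- move=> l; rewrite (functional_trig _ (linL l)).
  transitivity ((c *m A) 0 l); last by rewrite cA mxE.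
  rewrite mxE -[LHS]sum_enum_val.
  by apply: eq_bigr => i _; rewrite enum_valK mxE.
- apply: (@lt_le_trans _ _ (Num.sqrt q)).
    by rewrite -(ger0_norm v0) -sqrtr_sqr ltr_sqrt// ltrBrDr.
  apply: le_trans cx _; apply: le_trans (ler_norm _) _.
  rewrite le_eqVlt; apply/orP; left; apply/eqP; congr `|_|.
  rewrite mxE /trig -[RHS]sum_enum_val.
  by apply: eq_bigr => i _; rewrite enum_valK PsiE.
Qed.

(** * Errors *)

(** An error below [v] would make the sets where [f] and [- f] are further than [v] from the common
    output [p] null. By the triangle inequality they cover the set where [|f|] exceeds [v], which is
    not null. *)
Lemma err_ge (R : realType) (lam : nat -> R) d n L phi (beta v : R) :
  (fun n => \sum_(0 <= k < n) lam k ^+ 2) @ \oo --> (1 : R) ->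
  (forall k, 0 <= grid_weight lam k <= beta) ->
  method lam d n L phi ->
  v < Num.sqrt (Num.max 0 (1 - n%:R * beta ^+ d)) ->
  (v%:E <= err lam d n L phi)%E.
Proof.
move=> lam1 wbeta [linL _] vlt; rewrite leNgt; apply/negP => errv.
have [K [u [x0 [Tx0 u1 Lu vx0]]]] := hard_function _ _ _ _ _ _ _ lam1 wbeta linL vlt.
pose f := trig lam u; pose g := trig lam (fun m => - u m).
have Lg i : L i g = 0.
  rewrite (functional_trig _ (linL i)); under eq_bigr do rewrite mulNr.
  by rewrite sumrN -(functional_trig _ (linL i)) Lu oppr0.
pose p := phi (fun=> 0).
have nullB h : Hball lam d h -> (forall i, L i h = 0) ->
    lnull d [set x | torus d x /\ v < `|h x - p x| ].
  move=> hB Lh; apply: esssupT_lt_lnull; apply: le_lt_trans errv.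
  apply: ereal_sup_ubound; exists h => //=.
  by congr (esssupT d _); apply/funext => x; congr (_ - phi _ x); apply/funext => i.
have nullf := nullB f (trig_Hball _ _ _ _ _ u1) Lu.
have nullg : lnull d [set x | torus d x /\ v < `|g x - p x| ].
  apply: nullB Lg; apply: trig_Hball.
  by under eq_bigr do rewrite sqrrN.
apply: (trig_gt_not_lnull _ _ _ _ _ _ _ Tx0 vx0).
apply: lnullS (lnullU _ _ _ _ nullf nullg) => x [Tx vx].
have [vf|fv] := ltP v `|f x - p x|; first by left.
right; split=> //; rewrite /g trigN -/f -[- f x - p x]opprD normrN.
have : `|f x *+ 2| <= `|f x - p x| + `|f x + p x|.
  by apply: le_trans (ler_normD _ _); rewrite addrACA addNr addr0 mulr2n.
by rewrite normrMn mulr2n; move: vx; rewrite -/f; lra.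
Qed.

Lemma init_err_eq1 (R : realType) (lam : nat -> R) d (beta : R) : (0 < d)%N ->
  (fun n => \sum_(0 <= k < n) lam k ^+ 2) @ \oo --> (1 : R) ->
  (forall k, 0 <= grid_weight lam k <= beta) ->
  init_err lam d = 1%E.
Proof.
move=> d0 lam1 wbeta; apply/eqP; rewrite eq_le; apply/andP; split.
  apply: ge_ereal_sup => _ [f fB <-]; apply: ereal_inf_lbound; exists 1 => //.
  apply: lnullS (lnull_set0 _ _ d0) => x [_]; apply/negP.
  by rewrite -leNgt; exact: (Hball_norm_le1 _ _ _ _ _ lam1 fB).
apply/lee_subgt0Pr => e e0; rewrite -EFinB.
(* With no information at all, [n = 0], the hard function exceeds [1 - e]. *)
have [||K [u [x0 [Tx0 u1 _ vx0]]]] :=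
  @hard_function R lam d 0 (fun _ _ => 0) beta (1 - e) lam1 wbeta.
- by case.
- rewrite mul0r subr0 (max_idPr _) ?ler01// sqrtr1; lra.
rewrite leNgt; apply/negP => lt_init.
apply: (trig_gt_not_lnull _ _ _ _ _ _ _ Tx0 vx0).
apply: esssupT_lt_lnull; apply: le_lt_trans lt_init.
by apply: ereal_sup_ubound; exists (trig lam u) => //; exact: trig_Hball.
Qed.

(** * The constant beta and the conclusions *)

Lemma has_ubound_betaOf (R : realType) (lam : nat -> R) (M : R) :
  (forall k, lam k ^+ 2 <= M) ->
  has_ubound ([set lam 0%N ^+ 2] `|` [set lam k.+1 ^+ 2 / 2 | k in [set: nat]]).
Proof.
move=> lamM; exists M => _ [->|[k _ <-]]; first exact: lamM.
by have := lamM k.+1; have := sqr_ge0 (lam k.+1); lra.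
Qed.

Lemma grid_weight_le_betaOf (R : realType) (lam : nat -> R) (M : R) k :
  (forall k, lam k ^+ 2 <= M) -> 0 <= grid_weight lam k <= betaOf lam.
Proof.
move=> lamM; have ubB := has_ubound_betaOf _ _ _ lamM.
rewrite /grid_weight; case: eqP => [_|/eqP k0].
  by rewrite sqr_ge0; apply: ub_le_sup => //; left.
rewrite divr_ge0 ?sqr_ge0//=; apply: ub_le_sup => //; right.
by exists `|k|.-1%N => //; rewrite prednK// absz_gt0.
Qed.

Lemma conclusions_betaOf (R : realType) (lam : nat -> R) :
  (forall k, 0 < lam k) -> lam 0%N < 1 ->
  (fun n => \sum_(0 <= k < n) lam k ^+ 2) @ \oo --> (1 : R) ->
  conclusions lam (betaOf lam).
Proof.
move=> lam_gt0 lam0 lam1.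
have lamM k : lam k ^+ 2 <= 1.
  apply: le_trans (sum_sqr_le1 _ _ k.+1 lam1).
  by rewrite big_nat_recr//= lerDr sumr_ge0// => i _; exact: sqr_ge0.
have wbeta k := grid_weight_le_betaOf _ _ _ k lamM.
have beta0 : 0 < betaOf lam.
  by have /andP[_] := wbeta 0; apply: lt_le_trans; rewrite exprn_gt0.
have beta1 : betaOf lam < 1.
  (* A supremum need not preserve strict bounds, so the terms with [k > 0] are bounded uniformly by
     1/2. *)
  have : betaOf lam <= Num.max (lam 0%N ^+ 2) (1 / 2).
    apply: ge_sup; first by exists (lam 0%N ^+ 2); left.
    move=> _ [->|[k _ <-]]; rewrite le_max ?lexx//.
    by apply/orP; right; have := lamM k.+1; lra.
  move=> /le_lt_trans; apply; rewrite gt_max expr_lt1 ?ltW// ?lam0 //=; lra.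
split; first by rewrite beta0.
move=> d d0.
have edet_ge n : ((Num.sqrt (Num.max 0 (1 - n%:R * betaOf lam ^+ d)))%:E <= edet lam d n)%E.
  apply: le_ereal_inf_tmp => _ [L [phi [Lphi ->]]].
  apply/lee_subgt0Pr => e e0; rewrite -EFinB.
  by apply: (err_ge _ _ _ _ _ _ _ _ lam1 wbeta Lphi); rewrite ltrBlDr ltrDl.
split; [exact: init_err_eq1 wbeta|exact: edet_ge|].
move=> eps /andP[eps0 eps1] n [L [phi [Lphi errle]]].
have : (edet lam d n <= eps%:E)%E.
  by apply: le_trans errle; apply: ereal_inf_lbound; exists L, phi.
move=> /(le_trans (edet_ge n)); rewrite lee_fin => le_eps.
rewrite mulrC ler_pdivrMr ?exprn_gt0//.
have : 1 - n%:R * betaOf lam ^+ d <= eps ^+ 2.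
  have m0 : 0 <= Num.max 0 (1 - n%:R * betaOf lam ^+ d) by rewrite le_max lexx.
  apply: (@le_trans _ _ (Num.max 0 (1 - n%:R * betaOf lam ^+ d))).
    by rewrite le_max lexx orbT.
  by rewrite -(sqr_sqrtr m0) ler_pXn2r// nnegrE ?sqrtr_ge0// ltW.
(* For [0 < eps < 1], [(1 - eps) ^+ 2 <= 1 - eps ^+ 2]. *)
by nra.
Qed.

(** * Korobov spaces *)

(* From [ln (1 - 1 / x) <= - 1 / x] and [1 + y <= exp y]. *)
Lemma powR_telescope (R : realType) (t x : R) : 1 < x -> 0 < t ->
  t * x `^ (- (t + 1)) <= (x - 1) `^ (- t) - x `^ (- t).
Proof.
move=> x1 t0; have x0 : 0 < x by lra.
have -> : x `^ (- (t + 1)) = x `^ (- t) / x.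
  by rewrite opprD powRD ?powR_inv1 ?ltW// (gt_eqF x0) implybT.
rewrite lerBrDr mulrCA -[X in _ + X]mulr1 -mulrDr.
have -> : (x - 1) `^ (- t) = x `^ (- t) * expR (- t * ln (1 - x^-1)).
  rewrite -[x in x - 1]mulr1 -{2}(mulfV (lt0r_neq0 x0)) -mulrBr powRM.
  - congr (_ * _); rewrite /powR ifF//; apply/negbTE.
    by rewrite subr_eq0 gt_eqF// invf_lt1.
  - exact: ltW.
  - by rewrite subr_ge0 invf_le1 ?ltW.
rewrite ler_pM2l ?powR_gt0//; apply: le_trans (expR_ge1Dx _); rewrite addrC lerD2l.
rewrite mulNr -mulrN ler_pM2l// lerNr.
by apply: le_ln1Dx; rewrite ltrN2 invf_lt1.
Qed.

(** The partial sums increase, and [powR_telescope] with [t = s - 1] bounds them by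
    [1 + 1 / (s - 1)]. *)
Lemma cvg_zeta (R : realType) (s : R) : 1 < s ->
  cvgn (fun n => \sum_(1 <= k < n) (k%:R `^ (- s) : R)).
Proof.
move=> s1; have t0 : 0 < s - 1 by rewrite subr_gt0.
apply: nondecreasing_is_cvgn.
  apply/nondecreasing_seqP => -[|n]; first by rewrite !big_geq.
  by rewrite [leRHS]big_nat_recr//= lerDl powR_ge0.
exists (1 + (s - 1)^-1) => _ [n _ <-].
have bound m : \sum_(1 <= k < m.+2) (k%:R `^ (- s) : R) <=
    1 + (1 - m.+1%:R `^ (- (s - 1))) / (s - 1).
  elim: m => [|m IH].
    by rewrite big_nat1 !powR1 subrr mul0r addr0.
  rewrite big_nat_recr//= -[leLHS]addrC -lerBrDl; apply: le_trans IH _.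
  rewrite -addrA lerD2l lerBrDl -lerBrDr -mulrBl ler_pdivlMr// mulrC.
  have := @powR_telescope _ (s - 1) m.+2%:R _ t0; rewrite subrK => -/(_ _)/le_trans -> //.
    by rewrite ltr1n.
  by rewrite -natr1 addrK; lra.
case: n => [|[|n]]; [| |apply: le_trans (bound n) _].
- by rewrite big_geq// addr_ge0// invr_ge0 ltW.
- by rewrite big_geq// addr_ge0// invr_ge0 ltW.
- rewrite lerD2l ler_pdivrMr// mulVf ?gt_eqF//.
Qed.

Lemma powR_sqr (R : realType) (x y : R) : 0 <= x -> (x `^ y) ^+ 2 = x `^ (2 * y).
Proof. by move=> x0; rewrite -powR_mulrn ?powR_ge0// -powRrM mulrC. Qed.

Lemma korobov_sqrS (R : realType) (r b0 b1 : R) k : 0 <= b1 ->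
  korobov r b0 b1 k.+1 ^+ 2 = b1 * k.+1%:R `^ (- (2 * r)).
Proof. by move=> b10; rewrite /= exprMn sqr_sqrtr// powR_sqr// mulrN. Qed.

(** The squares decrease in [k] for positive [k], so among the halved ones [k = 1], with value
    [b1 / 2], is the largest. *)
Lemma betaOf_korobov (R : realType) (r b0 b1 : R) :
  0 <= r -> 0 <= b0 -> 0 <= b1 ->
  betaOf (korobov r b0 b1) = Num.max b0 (b1 / 2).
Proof.
move=> r0 b00 b10.
have le_b1 k : korobov r b0 b1 k.+1 ^+ 2 <= b1.
  rewrite korobov_sqrS// ler_piMr// -[leRHS](powRr0 k.+1%:R) ler_powR ?ler1n//.
  by rewrite oppr_le0 mulr_ge0.
have b0E : korobov r b0 b1 0 ^+ 2 = b0 by rewrite /= sqr_sqrtr.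
have lamM k : korobov r b0 b1 k ^+ 2 <= Num.max b0 b1.
  by case: k => [|k]; rewrite le_max ?b0E ?lexx ?le_b1 ?orbT.
have ubB := has_ubound_betaOf _ _ _ lamM.
apply/le_anti/andP; split.
  apply: ge_sup; first by exists b0; left; rewrite b0E.
  move=> _ [->|[k _ <-]]; rewrite le_max ?b0E ?lexx//.
  by apply/orP; right; rewrite ler_pM2r ?invr_gt0// le_b1.
rewrite ge_max; apply/andP; split; apply: ub_le_sup => //; first by left; rewrite b0E.
by right; exists 0%N => //; rewrite korobov_sqrS// powR1 mulr1.
Qed.

Lemma korobov_sum_cvg (R : realType) (r b0 b1 : R) :
  1 / 2 < r -> 0 <= b0 -> 0 <= b1 ->
  (fun n => \sum_(0 <= k < n) korobov r b0 b1 k ^+ 2) @ \oo --> b0 + b1 * zeta (2 * r).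
Proof.
move=> r2 b00 b10; have s1 : 1 < 2 * r by lra.
rewrite -cvg_shiftS.
rewrite (_ : (fun n => _) = (fun n =>
    b0 + b1 * \sum_(1 <= k < n.+1) (k%:R `^ (- (2 * r)) : R))); last first.
  apply/funext => n; rewrite big_nat_recl//= sqr_sqrtr// big_add1 mulr_sumr; congr (_ + _).
  by apply: eq_bigr => k _; exact: korobov_sqrS.
apply: cvgD; first exact: cvg_cst.
apply: cvgM; first exact: cvg_cst.
rewrite (cvg_shiftS (fun n => \sum_(1 <= k < n) (k%:R `^ (- (2 * r)) : R))).
(* [zeta] is defined by [limn], which is the actual limit only once convergence is known. *)
exact: cvg_zeta.
Qed.

Theorem theorem3p1 (R : realType) :
  (forall lam : nat -> R,
     (forall k, 0 < lam k) -> 0 <= lam 0%N < 1 ->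
     (fun n => \sum_(0 <= k < n) lam k ^+ 2) @ \oo --> (1 : R) ->
     conclusions lam (betaOf lam)) /\
  (forall r b0 b1 : R,
     1 / 2 < r -> 0 < b0 -> 0 < b1 -> b0 + b1 * zeta (2 * r) = 1 ->
     conclusions (korobov r b0 b1) (Num.max b0 (b1 / 2))).
Proof.
split=> [lam lam_gt0 /andP[_ lam0] lam1|r b0 b1 r2 b00 b10 b01].
  exact: conclusions_betaOf.
have r0 : 0 <= r by lra.
have sum1 := korobov_sum_cvg _ _ _ _ r2 (ltW b00) (ltW b10); rewrite b01 in sum1.
have kor_gt0 k : 0 < korobov r b0 b1 k.
  by case: k => [|k] /=; rewrite ?mulr_gt0 ?sqrtr_gt0 ?powR_gt0.
rewrite -(betaOf_korobov _ r)//; last 2 first.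
- exact: ltW.
- exact: ltW.
apply: conclusions_betaOf => //.
(* The first two squares sum to at most 1 and the second is positive, so the first is below 1. *)
have := sum_sqr_le1 _ _ 2 sum1.
rewrite big_nat_recr//= big_nat1 => sum2.
have <- := expr_lt1 (ltn0Sn 1) (ltW (kor_gt0 0%N)).
by apply: lt_le_trans sum2; rewrite ltrDl exprn_gt0// (kor_gt0 1%N).
Qed.
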